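(* Suppose $\kappa$ is a regular uncountable cardinal and $\square_\kappa$ holds. Then there is a normal, uniform, downward coherent $\omega$-covering matrix for $\kappa^+$.
   Context: $\square_\kappa$ asserts the existence of $\langle C_\alpha\mid\alpha<\kappa^+\text{ limit}\rangle$ with each $C_\alpha$ club in $\alpha$ of order type $\le\kappa$ and $C_\beta\cap\alpha=C_\alpha$ whenever $\alpha$ is a limit point of $C_\beta$. For regular $\theta<\lambda$, a $\theta$-covering matrix for $\lambda$ is $\mathcal{D}=\langle D(i,\beta)\mid i<\theta,\beta<\lambda\rangle$ with $\beta=\bigcup_{i<\theta}D(i,\beta)$, $D(i,\beta)\subseteq D(j,\beta)$ for $i<j$, and for $\beta<\gamma<\lambda$, $i<\theta$ some $j<\theta$ with $D(i,\beta)\subseteq D(j,\gamma)$. $\beta_{\mathcal{D}}$ is the least $\beta$ such that $\mathrm{otp}(D(i,\gamma))<\beta$ for all $i,\gamma$; $\mathcal{D}$ is normal if $\beta_{\mathcal{D}}<\lambda$. $\mathcal{D}$ is uniform if for every limit $\beta<\lambda$ some $D(i,\beta)$ contains a club in $\beta$. $\mathcal{D}$ is downward coherent if for all $\alpha<\beta<\lambda$ and $i<\theta$ there is $j<\theta$ with $D(i,\beta)\cap\alpha\subseteq D(j,\alpha)$. *)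

(* Defs.v *)
From mathcomp Require Import all_boot all_order.
From mathcomp Require Import all_classical.
From mathcomp Require Export wochoice.
Set Implicit Arguments.
Unset Strict Implicit.
Unset Printing Implicit Defensive.
Import Order.TTheory.
Local Open Scope classical_set_scope.
Local Open Scope card_scope.
Local Open Scope order_scope.

(* Ordinals are the elements of a type O well-ordered by <=%O; an ordinal a is
   identified with its initial segment [seg a], which has order type a. In the
   intended use O has an element of order type kappa^+, so that every ordinal
   up to and including kappa^+ is (uniquely) an element of O. *)
Section Ordinals.
Context {d : Order.disp_t} {O : orderType d}.
Implicit Types (a b c g i j k l t : O) (A B : set O).

Definition seg a : set O := [set x | x < a].

Definition is_least A a := A a /\ lbound A a.

(* 0 is not a limit ordinal. *)
Definition is_limit a := seg a !=set0 /\ forall x, x < a -> exists2 y, x < y & y < a.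

Definition is_omega a := is_least is_limit a.

(* otp(A) = a *)
Definition is_otp A a :=
  exists2 f : O -> O, set_bij A (seg a) f &
    forall x y, A x -> A y -> x < y -> f x < f y.

Definition otp_le A b := exists2 a, is_otp A a & a <= b.
Definition otp_lt A b := exists2 a, is_otp A a & a < b.

Definition is_cardinal a := forall b, b < a -> ~ (seg b #= seg a).

Definition is_succ_cardinal k l := is_least [set m | is_cardinal m /\ k < m] l.

Definition cofinal_map b a (f : O -> O) :=
  set_fun (seg b) (seg a) f /\
  forall x, x < a -> exists2 y, y < b & x <= f y.

(* cf(a) = b *)
Definition is_cofinality a b := is_least [set c | exists f, cofinal_map c a f] b.

Definition regular_cardinal k :=
  [/\ is_cardinal k, is_limit k & is_cofinality k k].

(* This forces a to be a limit ordinal; a need not belong to A. *)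
Definition limit_point A a :=
  seg a !=set0 /\ forall x, x < a -> exists2 y, A y & x < y < a.

Definition club_in a A :=
  [/\ A `<=` seg a,
      forall x, x < a -> exists2 y, A y & x <= y
    & forall g, g < a -> limit_point A g -> A g].

(* square_kappa, where l stands for kappa^+. The values of C outside the limit
   ordinals below l are irrelevant; a limit point of the club C b of b is at
   most b, hence below l. *)
Definition square k l :=
  exists C : O -> set O,
    (forall a, a < l -> is_limit a -> club_in a (C a) /\ otp_le (C a) k) /\
    (forall a b, b < l -> is_limit b -> limit_point (C b) a ->
       C b `&` seg a = C a).

Section CoveringMatrix.
(* Only the entries D i b with i < t and b < l are relevant. *)
Variables (t l : O) (D : O -> O -> set O).

Definition covering_matrix :=
  [/\ forall b, b < l -> seg b = \bigcup_(i in seg t) D i b,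
      forall i j b, i < j -> j < t -> b < l -> D i b `<=` D j b
    & forall b g i, b < g -> g < l -> i < t ->
        exists2 j, j < t & D i b `<=` D j g].

(* beta_D = b *)
Definition is_beta b :=
  is_least [set c | forall i g, i < t -> g < l -> otp_lt (D i g) c] b.

(* For a covering matrix otp(D i g) <= g < l, so beta_D exists and is <= l. *)
Definition normal := exists2 b, is_beta b & b < l.

Definition uniform :=
  forall b, b < l -> is_limit b ->
    exists2 i, i < t & exists2 A, club_in b A & A `<=` D i b.

Definition downward_coherent :=
  forall a b i, a < b -> b < l -> i < t ->
    exists2 j, j < t & D i b `&` seg a `<=` D j a.

End CoveringMatrix.
End Ordinals.

(* Main.v *)
Require Import Defs.
From mathcomp Require Import all_boot all_order all_classical.
Set Implicit Arguments.
Unset Strict Implicit.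
Unset Printing Implicit Defensive.
Import Order.TTheory.
Local Open Scope classical_set_scope.
Local Open Scope card_scope.
Local Open Scope order_scope.

(** Walk along the square sequence and let [D(n, b)] be the set of [a < b] that
    the minimal walk from [b] reaches in at most [n] steps. Coherence of the
    square sequence implies that for [a < b] the lengths of the walks from [a]
    and from [b] to a common target [x < a] differ by an amount independent of
    [x]; this gives both the covering and the downward coherence property. Since
    [C_b] is reached in one step, the matrix is uniform, and since [C_b] has
    order type at most [kappa], [D(n, b)] embeds in the [n]-fold lexicographic
    power of [kappa], a bound below [kappa^+] that does not depend on [b]. *)

(** * Cardinal inequalities as injections between sets *)

Lemma card_le_fun (T U : Type) (u0 : U) (A : set T) (B : set U) :
  A #<= B -> exists2 f : T -> U, set_fun A B f & set_inj A f.
Proof.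
by move=> /card_leP[f]; apply/injfunPex; squash (valLR u0 f).
Qed.

Lemma fun_card_le (T U : Type) (A : set T) (B : set U) (f : T -> U) :
  set_fun A B f -> set_inj A f -> A #<= B.
Proof.
move=> Af fI; have /injfunPex[g] : exists2 f, set_fun A B f & set_inj A f.
  by exists f.
exact: inj_card_le g.
Qed.

Definition lexf {d : Order.disp_t} {O : orderType d} (T : Type) (f : T -> O)
  (R : T -> T -> Prop) (p q : T) := f p < f q \/ (f p = f q /\ R p q).

(** * Induction, ranks and order types in a well-ordered type *)

Section WellOrder.
Context {d : Order.disp_t} {O : orderType d}.
Hypothesis woO : well_order (<=%O : rel O).
Implicit Types (a b c x y z k l : O) (A : set O).

Lemma ex_least A : A !=set0 -> exists a, is_least A a.
Proof.
case=> x Ax; have [|z [[Az lz] _]] := woO (A := [pred x | `[< A x >]]).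
  by exists x; apply/asboolP.
by exists z; split=> [|y Ay]; [exact/asboolP | apply: lz; apply/asboolP].
Qed.

Lemma wf_lt : well_founded (fun x y : O => x < y).
Proof.
move=> x; apply: contrapT => nx.
have [|z [nz lz]] := @ex_least [set x | ~ Acc (fun x y : O => x < y) x].
  by exists x.
apply: nz; constructor=> y yz; apply: contrapT => ny.
by have := lz _ ny; rewrite leNgt yz.
Qed.

Lemma lt_wf_ind (P : O -> Prop) :
  (forall x, (forall y, y < x -> P y) -> P x) -> forall x, P x.
Proof. exact: (well_founded_ind wf_lt). Qed.

Lemma wf_preimage (T : Type) (f : T -> O) :
  well_founded (fun p q => f p < f q).
Proof.
move=> p; have [x] : exists x, f p = x by exists (f p).
elim/lt_wf_ind: x p => x IHx p fpx; constructor=> q.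
by rewrite fpx => qx; exact: (IHx (f q)).
Qed.

Lemma wf_lexf (T : Type) (f : T -> O) (R : T -> T -> Prop) :
  well_founded R -> well_founded (lexf f R).
Proof.
move=> wfR p; have [x] : exists x, f p = x by exists (f p).
elim/lt_wf_ind: x p => x IHx p; elim/(well_founded_ind wfR): p => p IHp fpx.
constructor=> q [qp|[qp Rqp]]; first by apply: (IHx (f q)); rewrite -?fpx.
by apply: IHp; rewrite ?qp.
Qed.

Section Rank.
Variables (T : Type) (R : T -> T -> Prop) (wfR : well_founded R).
Variables (A : set T) (o0 : O).

(* Junk value [o0] where no ordinal exceeds all the ranks below. *)
Definition rank : T -> O :=
  Fix wfR (fun=> O) (fun p F =>
    xget o0 (is_least [set y | forall q (qp : R q p), A q -> F q qp < y])).

Lemma rankE p :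
  rank p = xget o0 (is_least [set y | forall q, R q p -> A q -> rank q < y]).
Proof.
rewrite /rank Fix_eq // => q f g fg; congr (xget _ (is_least _)).
by apply/seteqP; split=> y h r rq Ar; [rewrite -fg | rewrite fg]; exact: h.
Qed.

Lemma rank_least p y : (forall q, R q p -> A q -> rank q < y) ->
  is_least [set y | forall q, R q p -> A q -> rank q < y] (rank p).
Proof.
by move=> py; rewrite rankE; apply: xgetPex; apply: ex_least; exists y.
Qed.

Lemma rank_mono (g : T -> O) p :
  (forall p q, A p -> A q -> R q p -> g q < g p) -> A p ->
  rank p <= g p /\ forall q, A q -> R q p -> rank q < rank p.
Proof.
move=> gmono; elim/(well_founded_ind wfR): p => p IHp Ap.
have gp q : R q p -> A q -> rank q < g p.
  by move=> qp Aq; apply: le_lt_trans (gmono _ _ Ap Aq qp); case: (IHp q).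
have [h lh] := rank_least gp; split; first exact: lh.
by move=> q Aq qp; exact: h.
Qed.

(** By induction the ranks of predecessors are below [l]; the hypothesis, applied to [rank] itself,
    gives them one common bound below [l]. *)
Lemma rank_lt_bound l p :
  (forall p (f : T -> O), A p -> (forall q, A q -> R q p -> f q < l) ->
     exists2 z, z < l & forall q, A q -> R q p -> f q < z) ->
  A p -> rank p < l /\ forall q, A q -> R q p -> rank q < rank p.
Proof.
move=> bnd; elim/(well_founded_ind wfR): p => p IHp Ap.
have [|z zl hz] := bnd p rank Ap; first by move=> q Aq qp; case: (IHp q).
have [|h lh] := @rank_least p z; first by move=> q qp Aq; exact: hz.
split; first by apply: le_lt_trans zl; apply: lh => q qp Aq; exact: hz.
by move=> q Aq qp; exact: h.
Qed.

End Rank.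

(** The rank restricted to [A] is the transitive collapse: it lies pointwise below [g] and its range
    is an initial segment, whose least strict upper bound is the order type. *)
Lemma otp_le_mono A b (g : O -> O) :
  (forall x, A x -> g x < b) -> (forall x y, A x -> A y -> x < y -> g x < g y) ->
  otp_le A b.
Proof.
move=> gb gmono; pose r := rank wf_lt A b.
have rP p : A p -> r p <= g p /\ forall q, A q -> q < p -> r q < r p.
  by apply: rank_mono => q q' Aq Aq'; exact: gmono.
(* The range is downward closed: a missed [y < r x] would bound all ranks below [x], forcing
   [r x <= y]. *)
have onto x : A x -> forall y, y <= r x -> exists2 z, A z & r z = y.
  elim/lt_wf_ind: x => x IHx Ax y; rewrite le_eqVlt => /orP[/eqP->|yx].
    by exists x.
  apply: contrapT => ny.
  have yub q : q < x -> A q -> r q < y.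
    move=> qx Aq; rewrite ltNge; apply/negP => yq; apply: ny.
    exact: (IHx q).
  have [_ /(_ y yub)] := rank_least yub; by rewrite leNgt yx.
have bub x : A x -> r x < b by move=> Ax; apply: le_lt_trans (gb _ Ax); case: (rP _ Ax).
have [|a [au al]] := @ex_least [set y | forall x, A x -> r x < y]; first by exists b.
exists a; last exact: al.
exists r; last by move=> x y Ax Ay xy; case: (rP _ Ay) => _; exact.
split=> [x Ax|x y|y ya]; first exact: au.
  rewrite !inE => Ax Ay; have [_ hx] := rP _ Ax; have [_ hy] := rP _ Ay.
  by case: (ltgtP x y) => // [xy|yx] e; [have := hy _ Ax xy | have := hx _ Ay yx];
    rewrite e ltxx.
apply: contrapT => ny; have : a <= y.
  apply: al => x Ax; rewrite ltNge; apply/negP => yx; apply: ny.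
  by have [z Az] := onto x Ax y yx; exists z.
by rewrite leNgt ya.
Qed.

(** * Regularity as a bounding principle, and well-orders on pairs *)

(* For limit [l], this says that [l] is a regular cardinal. *)
Definition bounding l := forall x (f : O -> O), x < l ->
  (forall y, y < x -> f y < l) -> exists2 z, z < l & forall y, y < x -> f y < z.

(** Bound each row first, then bound the row bounds. Outside [A] the value [a] is a harmless
    default, being below [l]. *)
Lemma bounding_prod l a b (A : set (O * O)) (f : O * O -> O) :
  bounding l -> a < l -> b < l -> (forall p, A p -> p.1 < a /\ p.2 < b) ->
  (forall p, A p -> f p < l) -> exists2 z, z < l & forall p, A p -> f p < z.
Proof.
move=> bnd al bl Aab fl.
pose g x y := if pselect (A (x, y)) is left _ then f (x, y) else a.
have gl x y : g x y < l by rewrite /g; case: pselect => // /fl.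
have hx x : exists z, z < l /\ forall y, y < b -> g x y < z.
  by have [|z zl hz] := bnd b (g x) bl; [move=> y _; exact: gl | exists z].
have [h hP] := choice hx.
have [|z zl hz] := bnd a h al; first by move=> x _; case: (hP x).
exists z => // -[x y] Axy; have [/= xa yb] := Aab _ Axy.
have := (hP x).2 _ yb; rewrite /g; case: pselect => // _ fh.
exact: lt_trans fh (hz _ xa).
Qed.

Lemma regular_bounding k : regular_cardinal k -> bounding k.
Proof.
move=> [_ _ [_ kl]] x f xk fk; apply: contrapT => nb.
have /kl : exists f, cofinal_map x k f.
  exists f; split=> [y|z zk]; first exact: fk.
  apply: contrapT => nz; apply: nb; exists z => // y yx.
  by rewrite ltNge; apply/negP => zy; apply: nz; exists y.
by rewrite leNgt xk.
Qed.

(* Goedel's order on pairs: by maximum, then lexicographically. Initial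
   segments lie in squares of smaller ordinals, so ranks stay below [k]. *)
Lemma pairing k : is_limit k -> bounding k ->
  exists2 P : O -> O -> O, (forall x y, x < k -> y < k -> P x y < k) &
    forall x y x' y', x < k -> y < k -> x' < k -> y' < k ->
      P x y = P x' y' -> x = x' /\ y = y'.
Proof.
move=> [_ lk] bk.
pose R0 (p q : O * O) : Prop := p.2 < q.2.
have wfR0 : well_founded R0 := wf_preimage snd.
pose R1 := lexf fst R0; have wfR1 : well_founded R1 := wf_lexf _ wfR0.
pose R := lexf (fun p : O * O => Order.max p.1 p.2) R1.
have wfR : well_founded R := wf_lexf _ wfR1.
pose A := [set p : O * O | p.1 < k /\ p.2 < k].
have rP p : A p -> rank wfR A k p < k /\
    forall q, A q -> R q p -> rank wfR A k q < rank wfR A k p.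
  apply: rank_lt_bound => -[c e] f [/= ck ek] fk.
  (* All predecessors of [(c, e)] lie in the square of [m], so [bounding_prod] applies. *)
  have [m mc mk] : exists2 m, Order.max c e < m & m < k.
    by apply: lk; rewrite gt_max ck ek.
  have [[x y] [_ Rxy]|q []|z zk hz] :=
      bounding_prod (A := [set q | A q /\ R q (c, e)]) (f := f) bk mk mk.
  - have : Order.max x y <= Order.max c e by case: Rxy => [/ltW|[->]].
    by rewrite ge_max => /andP[xm ym]; split; exact: le_lt_trans mc.
  - exact: fk.
  - by exists z => // q Aq qp; exact: hz.
have tot p q : [\/ R p q, R q p | p = q].
  rewrite /R /R1 /R0 /lexf.
  case: (ltgtP (Order.max p.1 p.2) (Order.max q.1 q.2)) => e.
  - by constructor 1; left.
  - by constructor 2; left.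
  case: (ltgtP p.1 q.1) => e1.
  - by constructor 1; right; split => //; left.
  - by constructor 2; right; split => //; left.
  case: (ltgtP p.2 q.2) => e2.
  - by constructor 1; right; split => //; right.
  - by constructor 2; right; split => //; right.
  by constructor 3; move: p q e1 e2 {e} => [? ?] [? ?] /= -> ->.
exists (fun x y => rank wfR A k (x, y)) => [x y xk yk|x y x' y' xk yk x'k y'k e].
  by case: (rP (x, y)).
have A1 : A (x, y) by [].
have A2 : A (x', y') by [].
have [h|h|[-> ->]//] := tot (x, y) (x', y').
  by have [_ /(_ _ A1 h)] := rP _ A2; rewrite e ltxx.
by have [_ /(_ _ A2 h)] := rP _ A1; rewrite e ltxx.
Qed.

(** Ranks in the lexicographic order on [a * b]; [bounding_prod] keeps each rank below [l] and then
    bounds all of them at once. *)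
Lemma lex_embedding l a b : bounding l -> a < l -> b < l ->
  exists2 h : O -> O -> O,
    (exists2 z, z < l & forall x y, x < a -> y < b -> h x y < z) &
    forall x y x' y', x < a -> y < b -> x' < a -> y' < b ->
      x < x' \/ (x = x' /\ y < y') -> h x y < h x' y'.
Proof.
move=> bnd al bl.
pose R0 (p q : O * O) : Prop := p.2 < q.2.
have wfR0 : well_founded R0 := wf_preimage snd.
pose R := lexf fst R0; have wfR : well_founded R := wf_lexf _ wfR0.
pose A := [set p : O * O | p.1 < a /\ p.2 < b].
have rP p : A p -> rank wfR A l p < l /\
    forall q, A q -> R q p -> rank wfR A l q < rank wfR A l p.
  apply: rank_lt_bound => p' f _ fl.
  have [q []//|q []|z zl hz] :=
      bounding_prod (A := [set q | A q /\ R q p']) (f := f) bnd al bl.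
  - exact: fl.
  - by exists z => // q Aq qp; exact: hz.
exists (fun x y => rank wfR A l (x, y)).
  have [p|p|z zl hz] := bounding_prod (A := A) (f := rank wfR A l) bnd al bl.
  - by [].
  - by case/rP.
  - by exists z => // x y xa yb; exact: hz.
by move=> x y x' y' xa yb xa' yb' h; have [//|_] := rP (x', y'); apply.
Qed.

(** * Regularity of the successor cardinal *)

Lemma lt_succ_cardinal_card k l x : is_succ_cardinal k l -> x < l -> seg x #<= seg k.
Proof.
move=> [[cl kl] ll] xl.
have [|m [mx lm]] := @ex_least [set m | seg m #= seg x]; first by exists x => /=.
have cm : is_cardinal m.
  move=> b bm bm'; have := lm b; rewrite /= leNgt bm => /(_ (card_eq_trans bm' mx)).
  by [].
have mk : m <= k.
  rewrite leNgt; apply/negP => km.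
  have := ll m; rewrite /= leNgt => /(_ (conj cm km)); apply/negP.
  by rewrite negbK; apply: le_lt_trans xl; apply: lm => /=.
move: mx => /=; rewrite card_eq_le => /andP[_ xm]; apply: card_le_trans xm _.
by apply: subset_card_le => y /= ym; exact: lt_le_trans mk.
Qed.

Lemma succ_cardinal_card k l : is_succ_cardinal k l -> ~ (seg l #<= seg k).
Proof.
move=> [[cl kl] _] lk; apply: (cl k kl); rewrite card_eq_le lk andbT.
by apply: subset_card_le => y /= yk; exact: lt_trans kl.
Qed.

(** If [f] were unbounded on [x], each [z < l] would lie below some [f (y z)]. Coding [z] by [y z]
    and its place in [f (y z)], both injected into [k] and then paired, would inject [l] into
    [k]. *)
Lemma succ_cardinal_bounding k l :
  regular_cardinal k -> is_succ_cardinal k l -> bounding l.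
Proof.
move=> rk sl; have [_ lk _] := rk.
have [P Pk Pinj] := pairing lk (regular_bounding rk).
have [[o ok] /(_ _ ok)[o' oo' ok']] := lk.
have inj_le x : exists j : O -> O, x < l ->
    (forall y, y <= x -> j y < k) /\
    forall y z, y <= x -> z <= x -> j y = j z -> y = z.
  have [xl|] := boolP (x < l); last by exists id.
  have [j jk ij] := card_le_fun k (lt_succ_cardinal_card sl xl).
  (* The tags [o] and [o'] keep the endpoint [x] apart from the points below it. *)
  exists (fun y => if y < x then P o (j y) else P o' o) => _; split.
    by move=> y _; case: ifP => yx; apply: Pk => //; exact: jk.
  move=> y z yx zx.
  have [yx'|yx'] := ltP y x; have [zx'|zx'] := ltP z x => e.
  - have [_ {}e] := Pinj _ _ _ _ ok (jk _ yx') ok (jk _ zx') e.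
    by apply: ij => //; rewrite inE.
  - have [e' _] := Pinj _ _ _ _ ok (jk _ yx') ok' ok e.
    by move: oo'; rewrite e' ltxx.
  - have [e' _] := Pinj _ _ _ _ ok' ok ok (jk _ zx') e.
    by move: oo'; rewrite e' ltxx.
  - by apply/le_anti; rewrite (le_trans yx) //= (le_trans zx).
have [j jP] := choice inj_le.
move=> x f xl fl; apply: contrapT => nb.
have hy z : exists y, z < l -> y < x /\ z <= f y.
  have [zl|] := boolP (z < l); last by exists z.
  apply: contrapT => nz; apply: nb; exists z => // y yx.
  by rewrite ltNge; apply/negP => zy; apply: nz; exists y.
have [y yP] := choice hy.
apply: (succ_cardinal_card sl).
apply: (@fun_card_le _ _ _ _ (fun z => P (j x (y z)) (j (f (y z)) z))).
  move=> z /= zl; have [yx zy] := yP _ zl.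
  apply: Pk; first by case: (jP _ xl) => + _; apply; exact: ltW.
  by case: (jP _ (fl _ yx)) => + _; apply.
move=> z z'; rewrite !inE /= => zl zl'; have [yx zy] := yP _ zl; have [yx' zy'] := yP _ zl'.
have [jk ij] := jP _ xl.
have [jk1 ij1] := jP _ (fl _ yx); have [jk2 _] := jP _ (fl _ yx').
have jkx u : u < x -> j x u < k by move=> ux; apply: jk; exact: ltW.
move=> /(Pinj _ _ _ _ (jkx _ yx) (jk1 _ zy) (jkx _ yx') (jk2 _ zy'))[e1].
have e2 : y z = y z' by apply: ij => //; exact: ltW.
by rewrite -e2; apply: ij1 => //; rewrite e2.
Qed.

End WellOrder.

(** * Minimal walks along the square sequence *)

Section Walks.
Context {d : Order.disp_t} {O : orderType d}.
Hypothesis woO : well_order (<=%O : rel O).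
Implicit Types (a b c x y z k l : O) (A : set O).
Variable C : O -> set O.

(* [C_b] at [0] and successors follows the usual convention for walks:
   empty at [0], and [{c}] at [c + 1]. *)
Definition walk_club b : set O :=
  [set c | (is_limit b /\ C b c) \/
           (~ is_limit b /\ c < b /\ forall y, y < b -> y <= c)].

Definition next_step b a c := is_least [set y | walk_club b y /\ a <= y] c.

(* Todorcevic's [rho_2 a b <= n]: the minimal walk from [b] down to [a] has at
   most [n] steps. *)
Fixpoint walk_le n a b : Prop :=
  a = b \/
  if n is n'.+1 then a < b /\ exists2 c, next_step b a c & walk_le n' a c
  else False.

Lemma walk_le_le n a b : walk_le n a b -> a <= b.
Proof. by case: n => [[->|]//|n [->//|[/ltW]]]. Qed.

Lemma walk_leW m n a b : (m <= n)%N -> walk_le m a b -> walk_le n a b.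
Proof.
elim: m n b => [|m IHm] [|n] b //=; first by move=> _ [->|//]; left.
move=> mn [->|[ab [c abc w]]]; first by left.
by right; split=> //; exists c => //; exact: IHm.
Qed.

Lemma next_step_unique b a c c' : next_step b a c -> next_step b a c' -> c = c'.
Proof. by move=> [hc lc] [hc' lc']; apply/le_anti; rewrite lc //= lc'. Qed.

Lemma walk_leS n a b c : a < b -> next_step b a c ->
  walk_le n.+1 a b <-> walk_le n a c.
Proof.
move=> ab abc; split=> /= [[e|[_ [c' /(next_step_unique abc) <-]]]//|w].
  by move: ab; rewrite e ltxx.
by right; split=> //; exists c.
Qed.

Variables k l : O.
Hypothesis clubC : forall a, a < l -> is_limit a ->
  club_in a (C a) /\ otp_le (C a) k.
Hypothesis cohC : forall a b, b < l -> is_limit b -> limit_point (C b) a ->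
  C b `&` seg a = C a.

Lemma walk_club_lt b c : b < l -> walk_club b c -> c < b.
Proof.
move=> bl [[lb Cbc]|[_ [//]]].
by have [[sub _ _] _] := clubC bl lb; exact: sub.
Qed.

Lemma ex_next_step b a : b < l -> a < b -> exists c, next_step b a c.
Proof.
move=> bl ab; apply: (ex_least woO).
have [lb|nlb] := pselect (is_limit b).
  have [[_ unb _] _] := clubC bl lb.
  by have [y Cy ay] := unb _ ab; exists y; split=> //; left.
have [c cb hc] : exists2 c, c < b & forall y, y < b -> y <= c.
  apply: contrapT => nc; apply: nlb; split=> [|x xb]; first by exists a.
  apply: contrapT => ny; apply: nc; exists x => // y yb.
  by rewrite leNgt; apply/negP => xy; apply: ny; exists y.
by exists c; split; [right | exact: hc].
Qed.

Lemma next_step_lt b a c : b < l -> next_step b a c -> a <= c /\ c < b.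
Proof. by move=> bl [[hc ac] _]; split=> //; exact: walk_club_lt hc. Qed.

Lemma walk_club_coherent a b : b < l -> a < b -> limit_point (walk_club b) a ->
  walk_club b `&` seg a = walk_club a.
Proof.
move=> bl ab [ne lim].
have la : is_limit a by split=> // x /lim[y _ /andP[]]; exists y.
(* At a nonlimit [b] the only point of [walk_club b] is the maximum below [b], so no [a < b] is a
   limit point. *)
have lb : is_limit b.
  apply: contrapT => nlb; have [x xa] := ne.
  have [y [[]//|[_ [_ hy]]] /andP[_ ya]] := lim x xa.
  by have := hy a ab; rewrite leNgt ya.
have eb c : walk_club b c <-> C b c.
  by split=> [[[]//|[]//]|]; left.
have ea c : walk_club a c <-> C a c.
  by split=> [[[]//|[]//]|]; left.
have /(cohC bl lb) e : limit_point (C b) a.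
  by split=> // x /lim[y /eb]; exists y.
apply/seteqP; split=> c; first by move=> [/eb bc ca]; apply/ea; rewrite -e.
by move=> /ea; rewrite -e => -[/eb].
Qed.

(** * Finiteness of walks and comparison of their lengths *)

Lemma walk_ex a b : b < l -> a <= b -> exists n, walk_le n a b.
Proof.
elim/(lt_wf_ind woO): b => b IHb bl; rewrite le_eqVlt => /orP[/eqP->|ab].
  by exists 0%N; left.
have [c abc] := ex_next_step bl ab.
have [ac cb] := next_step_lt bl abc.
have [n w] := IHb c cb (lt_trans cb bl) ac.
by exists n.+1; apply/(walk_leS _ ab abc).
Qed.

(** Walk lengths from [a] and [b] differ by at most [m], uniformly over targets in [A]. This is an
    equivalence relation in [a] and [b], so comparisons can be chained. *)
Definition near A a b := exists m, forall x n, A x ->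
  (walk_le n x a -> walk_le (n + m) x b) /\
  (walk_le n x b -> walk_le (n + m) x a).

Lemma near_refl A a : near A a a.
Proof. by exists 0%N => x n _; rewrite addn0. Qed.

Lemma near_sym A a b : near A a b -> near A b a.
Proof. by case=> m h; exists m => x n /(h _ n)[]. Qed.

Lemma near_trans A b a c : near A a b -> near A b c -> near A a c.
Proof.
move=> [m h] [m' h']; exists (m + m')%N => x n Ax; split=> w.
  by rewrite addnA; apply/(h' x _ Ax).1/(h x _ Ax).1.
by rewrite [(m + m')%N]addnC addnA; apply/(h x _ Ax).2/(h' x _ Ax).2.
Qed.

Lemma near_sub A A' a b : A `<=` A' -> near A' a b -> near A a b.
Proof. by move=> s [m h]; exists m => x n /s/h. Qed.

Lemma near_setU A A' a b : near A a b -> near A' a b -> near (A `|` A') a b.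
Proof.
move=> [m h] [m' h']; exists (m + m')%N => x n [/(h _ n)[h1 h2]|/(h' _ n)[h1 h2]];
  split=> [/h1|/h2]; apply: walk_leW; rewrite ?leq_add2l ?leq_addr ?leq_addl //.
Qed.

Lemma near_set1 x a b : a < l -> b < l -> x <= a -> x <= b -> near [set x] a b.
Proof.
move=> al bl xa xb; have [p wp] := walk_ex al xa; have [q wq] := walk_ex bl xb.
exists (p + q)%N => y n ->; split=> _.
  by apply: walk_leW wq; rewrite addnA leq_addl.
by apply: walk_leW wp; rewrite addnCA leq_addr.
Qed.

(* The walks from [a] and [b] to a common target have lengths differing by a
   bounded amount. If [a] is a limit point of [C_b] the first steps agree.
   Otherwise some interval ]x, a[ misses [C_b], so that targets in it are
   reached from [b] through the first step of the walk from [b] to [a]. *)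
Lemma walk_near a b : b < l -> a <= b -> near (seg a) a b.
Proof.
elim/(lt_wf_ind woO): b a => b IHb a bl.
elim/(lt_wf_ind woO): a => a IHa.
rewrite le_eqVlt => /orP[/eqP->|ab]; first exact: near_refl.
have [la|nla] := pselect (limit_point (walk_club b) a).
  have e := walk_club_coherent bl ab la.
  (* Some point of [walk_club b] lies between [x] and [a], so the least one above [x] is decided
     below [a], where the two clubs agree. *)
  have es x c : x < a -> next_step a x c <-> next_step b x c.
    move=> xa; have [y by_ /andP[xy ya]] := la.2 x xa.
    split=> -[[hc xc] lc].
      move: hc; rewrite -e => -[hc ca]; split=> // z [hz xz].
      have [za|az] := ltP z a; first by apply: lc; split=> //; rewrite -e.
      by apply: le_trans az; exact: ltW.
    have cy : c <= y by apply: lc; split=> //; exact: ltW.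
    split; first by split=> //; rewrite -e; split=> //; exact: le_lt_trans ya.
    by move=> z; rewrite -e => -[[hz _] xz]; apply: lc.
  exists 0%N => x n; rewrite /seg /= addn0 => xa; have xb := lt_trans xa ab.
  case: n => [|n] /=; first by split=> -[e'|//]; move: xa xb; rewrite e' ltxx.
  split=> -[e'|[_ [c hc w]]]; try by move: xa xb; rewrite e' ltxx.
    by right; split=> //; exists c => //; apply/es.
  by right; split=> //; exists c => //; apply/es.
have [[x0 x0a]|na] := pselect (seg a !=set0); last first.
  by exists 0%N => x n xa; exfalso; apply: na; exists x.
have [x xa hx] : exists2 x, x < a & forall y, walk_club b y -> x < y -> a <= y.
  apply: contrapT => nx; apply: nla; split=> [|x xa]; first by exists x0.
  apply: contrapT => ny; apply: nx; exists x => // y by_ xy.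
  by rewrite leNgt; apply/negP => ya; apply: ny; exists y => //; rewrite xy.
have al := lt_trans ab bl.
(* Targets below [x] are compared through [x]: the outer induction relates [x] to [a], the inner one
   [x] to [b]. *)
have n1 : near (seg x) a b.
  have xb := lt_trans xa ab.
  apply: (near_trans (b := x)); first by apply: near_sym; apply: IHb => //; exact: ltW.
  by apply: IHa => //; exact: ltW.
have n2 : near [set x] a b by apply: near_set1 => //; [exact: ltW | exact/ltW/(lt_trans xa)].
have [c abc] := ex_next_step bl ab; have [ac cb] := next_step_lt bl abc.
(* Here [c] is the first step from [b] for all these targets, which costs 1; the outer induction at
   [c < b] relates [a] to [c]. *)
have n3 : near [set y | x < y < a] a b.
  apply: (near_trans (b := c)).
    apply: (near_sub (A' := seg a)); first by move=> y /andP[].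
    by apply: IHb => //; exact: lt_trans bl.
  exists 1%N => y n /andP[xy ya]; rewrite addn1.
  have ybc : next_step b y c.
    case: abc => -[bc _] lc; split=> [|z [bz yz]].
      by split=> //; apply: le_trans ac; exact: ltW.
    by apply: lc; split=> //; apply: hx => //; exact: lt_le_trans yz.
  have yb := lt_trans ya ab.
  split=> w; first exact/(walk_leS _ yb ybc).
  by apply: (walk_leW (leqnSn n)); apply/(walk_leS _ yb ybc); exact: walk_leW w.
apply: near_sub (near_setU n1 (near_setU n2 n3)) => y /= ya.
by case: (ltgtP y x) => [yx|xy|->]; [left | right; right; exact/andP | right; left].
Qed.

(** * Order types of the sets of targets reached in boundedly many steps *)

Hypothesis k_gt0 : seg k !=set0.

Lemma walk_club_mono b : b < l -> exists2 g : O -> O,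
  (forall y, walk_club b y -> g y < k) &
  forall y z, walk_club b y -> walk_club b z -> y < z -> g y < g z.
Proof.
move=> bl; have [lb|nlb] := pselect (is_limit b).
  have [_ [a [g [gf _ _] gm] ak]] := clubC bl lb.
  exists g => [y [[_ Cy]|[]//]|y z [[_ Cy]|[]//] [[_ Cz]|[]//]]; last exact: gm.
  exact: lt_le_trans (gf _ Cy) ak.
have [o ok] := k_gt0.
exists (fun=> o) => // y z [[]//|[_ [yb hy]]] [[]//|[_ [zb hz]]].
by rewrite ltNge hy.
Qed.

Hypotheses (bl : bounding l) (kl : k < l).

Lemma bounding_nomax z : z < l -> exists2 z', z' < l & z < z'.
Proof.
move=> zl; have [|z' zl' h] := bl (x := k) (f := fun=> z) kl; first by [].
by have [o ok] := k_gt0; exists z' => //; exact: h ok.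
Qed.

(* A target is placed lexicographically, by the first step of the walk and then
   by its position among the targets reached from there: order types stay
   below [k ^ n]. *)
Lemma walk_le_mono n : exists2 z, z < l & forall b, b < l -> exists2 g : O -> O,
  (forall a, walk_le n a b -> g a < z) &
  forall a a', walk_le n a b -> walk_le n a' b -> a < a' -> g a < g a'.
Proof.
elim: n => [|n [z zl IHn]].
  have [o ok] := k_gt0; exists k => // b _.
  by exists (fun=> o) => //= a a' [->|//] [->|//]; rewrite ltxx.
have [h [t tl ht] hmono] := lex_embedding woO bl kl zl.
have [t' tl' tt'] := bounding_nomax tl.
exists t' => // b bl0.
have hn c : exists g : O -> O, c < l -> (forall a, walk_le n a c -> g a < z) /\
    forall a a', walk_le n a c -> walk_le n a' c -> a < a' -> g a < g a'.
  have [cl|] := boolP (c < l); last by exists id.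
  by have [g g1 g2] := IHn c cl; exists g.
have [G GP] := choice hn.
have hs a : exists c, a < b -> next_step b a c.
  have [ab|] := boolP (a < b); last by exists a.
  by have [c] := ex_next_step bl0 ab; exists c.
have [s sP] := choice hs.
have [r rk rmono] := walk_club_mono bl0.
have in_ab a : a < b -> walk_le n.+1 a b ->
    [/\ walk_club b (s a), s a < l & walk_le n a (s a)].
  move=> ab w; have abs := sP _ ab; have [_ sb] := next_step_lt bl0 abs.
  split; [by case: abs => -[] | exact: lt_trans bl0 |].
  exact/(walk_leS _ ab abs).
(* The target [b] itself exceeds all others and gets [t], which bounds the values of [h]; hence the
   strict bound [t'] above [t]. *)
exists (fun a => if a < b then h (r (s a)) (G (s a) a) else t) => [a w|a a' w w' aa'].
  case: ifP => // ab; have [bs sl ws] := in_ab a ab w.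
  by apply: lt_trans tt'; apply: ht; [exact: rk | exact: (GP _ sl).1].
have ab : a < b by apply: lt_le_trans aa' _; exact: walk_le_le w'.
rewrite ab; have [bs sl ws] := in_ab a ab w.
case: ifP => [ab'|_]; last by apply: ht; [exact: rk | exact: (GP _ sl).1].
have [bs' sl' ws'] := in_ab a' ab' w'.
apply: hmono; rewrite ?rk ?(GP _ sl).1 ?(GP _ sl').1 //.
(* First steps are monotone in the target, because [s a'] is also a candidate for [a]. *)
have : s a <= s a'.
  have [_ ls] := sP _ ab; have [[_ as'] _] := sP _ ab'.
  by apply: ls; split=> //; apply: le_trans as'; exact: ltW.
rewrite le_eqVlt => /orP[/eqP e|ss]; last by left; exact: rmono.
by right; rewrite -e; split=> //; apply: (GP _ sl).2 => //; rewrite e.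
Qed.

End Walks.

Section Omega.
Context {d : Order.disp_t} {O : orderType d}.
Hypothesis woO : well_order (<=%O : rel O).

Lemma omega_enum (w : O) : is_omega w -> exists e : nat -> O,
  [/\ forall n, e n < w, {homo e : m n / (m < n)%N >-> m < n}
    & forall i, i < w -> exists n, i <= e n].
Proof.
move=> [[[o ow] lw] minw].
have hs x : exists y, x < w -> [/\ x < y, y < w & forall z, x < z -> y <= z].
  have [xw|] := boolP (x < w); last by exists x.
  have [y0 xy0 y0w] := lw x xw.
  have [|y [xy ly]] := @ex_least _ _ woO [set y | x < y]; first by exists y0.
  by exists y; split=> //; apply: le_lt_trans y0w; exact: ly.
have [s sP] := choice hs.
pose e n := iter n s o; have ew n : e n < w by elim: n => //= n /sP[].
have eS n : e n < e n.+1 by case: (sP _ (ew n)).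
exists e; split=> //; first by apply: homo_ltn => //; exact: lt_trans.
move=> i iw; apply: contrapT => ni.
have ei n : e n < i by rewrite ltNge; apply/negP => h; apply: ni; exists n.
have [|u [ub lu]] := @ex_least _ _ woO [set u | forall n, e n < u].
  by exists i.
have /minw : is_limit u.
  split=> [|x xu]; first by exists (e 0%N); exact: ub.
  apply: contrapT => ny; have : u <= x.
    apply: lu => n; rewrite ltNge; apply/negP => xn; apply: ny.
    by exists (e n.+1); [exact: le_lt_trans xn (eS n) | exact: ub].
  by rewrite leNgt xu.
by apply/negP; rewrite -ltNge; apply: le_lt_trans iw; exact: lu.
Qed.

End Omega.

(** * The covering matrix read off from walk lengths *)

Theorem theorem5p7 (d : Order.disp_t) (O : orderType d)
    (woO : well_order (<=%O : rel O)) (omega kappa kappa_plus : O)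
    (omegaP : is_omega omega)
    (kappa_reg : regular_cardinal kappa)
    (kappa_unc : ~ countable (seg kappa))
    (kappa_plusP : is_succ_cardinal kappa kappa_plus)
    (square_kappa : square kappa kappa_plus) :
  exists D : O -> O -> set O,
    [/\ covering_matrix omega kappa_plus D,
        normal omega kappa_plus D,
        uniform omega kappa_plus D
      & downward_coherent omega kappa_plus D].
Proof.
have [_ limk _] := kappa_reg; have [k0 _] := limk.
have [[_ kl] _] := kappa_plusP.
have bnd := succ_cardinal_bounding woO kappa_reg kappa_plusP.
have wk : omega <= kappa by apply: omegaP.2.
have [C [clubC cohC]] := square_kappa.
have [e [ew emono ecof]] := omega_enum woO omegaP.
have emonoW m n : e m <= e n -> (m <= n)%N.
  by rewrite leNgt leqNgt; apply: contra => /emono.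
(* The enumeration [e] translates an ordinal index below [omega] into a bound on the number of
   steps. *)
pose D i b := [set a | a < b /\ exists2 n, e n <= i & walk_le C n a b].
have Dn i b n : i <= e n -> D i b `<=` [set a | a < b /\ walk_le C n a b].
  move=> ie a [ab [m me w]]; split=> //; apply: walk_leW w.
  exact/emonoW/(le_trans me).
(* One shift of the index by [m] serves both directions: the first inclusion gives downward
   coherence, the second covering. *)
have nearD a b i : a <= b -> b < kappa_plus -> i < omega -> exists2 j, j < omega &
    (D i b `&` seg a `<=` D j a) /\ (D i a `<=` D j b).
  move=> ab bl iw; have [n ie] := ecof i iw.
  have [m hm] := walk_near woO clubC cohC bl ab.
  exists (e (n + m)%N) => //; split=> [x [/(Dn _ _ _ ie)[xb w] xa]|x /(Dn _ _ _ ie)[xa w]].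
    by split=> //; exists (n + m)%N => //; exact: (hm x n xa).2.
  by split; [exact: lt_le_trans ab | exists (n + m)%N => //; exact: (hm x n xa).1].
exists D; split.
- split=> [b bl|i j b ij _ _ a [ab [n ni w]]|b g i bg gl iw].
  + apply/seteqP; split=> [a ab|a [i _ [//]]].
    have [n w] := walk_ex woO clubC bl (ltW ab).
    by exists (e n); [exact: ew | split=> //; exists n].
  + by split=> //; exists n => //; exact: le_trans (ltW ij).
  + by have [j jw [_ h]] := nearD b g i (ltW bg) gl iw; exists j.
- have hz n : exists z, z < kappa_plus /\ forall b, b < kappa_plus -> exists2 g : O -> O,
      (forall a, walk_le C n a b -> g a < z) &
      forall a a', walk_le C n a b -> walk_le C n a' b -> a < a' -> g a < g a'.
    by have [z zl h] := walk_le_mono woO clubC k0 bnd kl n; exists z.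
  have [z zP] := choice hz.
  pose f i := xget kappa [set y | exists2 n, i <= e n & y = z n].
  have fP i : i < omega -> exists2 n, i <= e n & f i = z n.
    move=> iw; have [n ie] := ecof i iw.
    by apply: (@xgetPex _ kappa [set y | exists2 n, i <= e n & y = z n]); exists (z n), n.
  (* The bounds for all indices have a common bound below [kappa_plus], since
     [omega <= kappa < kappa_plus]. *)
  have [|t tl ht] := bnd omega f (le_lt_trans wk kl).
    by move=> i /fP[n _ ->]; case: (zP n).
  have tP i g : i < omega -> g < kappa_plus -> otp_lt (D i g) t.
    move=> iw gl; have [n ie fi] := fP i iw.
    have [h h1 h2] := (zP n).2 g gl.
    have [|x y|a Da al] := @otp_le_mono _ _ woO (D i g) (z n) h.
    + by move=> x /(Dn _ _ _ ie)[_ /h1].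
    + by move=> /(Dn _ _ _ ie)[_ xg] /(Dn _ _ _ ie)[_ yg]; exact: h2.
    + by exists a => //; apply: le_lt_trans al _; rewrite -fi; exact: ht.
  have [|b [bP lb]] := @ex_least _ _ woO
      [set c | forall i g, i < omega -> g < kappa_plus -> otp_lt (D i g) c].
    by exists t.
  by exists b => //; apply: le_lt_trans tl; exact: lb.
(* A point of [C b] is its own first step from [b], so one step suffices. *)
- move=> b bl lb; exists (e 1%N) => //; exists (C b); first by case: (clubC b bl lb).
  have [[sub _ _] _] := clubC b bl lb.
  move=> a Ca; have ab := sub _ Ca; split=> //; exists 1%N => //=; right; split=> //.
  exists a; last by left.
  by split=> [|y []//]; split=> //; left.
- move=> a b i ab bl iw; have [j jw [h _]] := nearD a b i (ltW ab) bl iw.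
  by exists j.
Qed.
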